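(* Let $G$ be a triangle-free graph of order $n$. Then $IC(G)=n$ if and only if (up to isomorphism) $$G\in\{C_4,C_5,C_6,P_1,P_2,P_3,P_4,\overline{K}_2,K_1\cup K_2,K_2\cup K_2,\mathcal{K}_0\}\cup\mathcal{K}.$$
   Context: Graphs are finite and simple with nonempty vertex set. $P_n$, $C_n$, $K_n$ are the path, cycle and complete graph of order $n$; $\overline{K}_2$ is the edgeless graph of order 2; $\cup$ between graphs denotes disjoint union. A graph is triangle-free if it has no $K_3$ as a subgraph. For vertex sets $X,Y$, $[X,Y]$ is full if every vertex of $X$ is adjacent to every vertex of $Y$, and empty if there are no edges between $X$ and $Y$. $\mathcal{K}_0$ is the bipartite graph with partite sets $H_1=\{v_1,v_2,v_3,v_4\}$ and $H_2=\{u_1,u_2,u_3,u_4\}$ in which, for each $1\le i\le 4$, $v_i$ is adjacent to all vertices of $H_2$ except $u_i$. $\mathcal{K}$ is the family of $4$-partite graphs with partite (independent) sets $H_1=\{v_1,v_2,v_3,v_4\}$, $H_2=\{u_1,u_2,u_3,u_4\}$, $H_3=\{n_1,\dots,n_k\}$, $H_4=\{m_1,\dots,m_k\}$, for $k\ge 1$, such that: $[H_1,H_3]$ and $[H_2,H_4]$ are full; $[H_1,H_4]$ and $[H_2,H_3]$ are empty; for each $1\le i\le 4$, $v_i$ is adjacent to all vertices of $H_2$ except $u_i$; for each $1\le i\le k$, $n_i$ is adjacent to all vertices of $H_4$ except $m_i$. A set $S$ of vertices is dominating if every vertex is in $S$ or adjacent to a vertex of $S$; it is independent if its vertices are pairwise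 nonadjacent; an independent dominating set is a set that is both independent and dominating. An independent coalition in $G$ consists of two disjoint independent sets of vertices $V_1,V_2$, neither of which is an independent dominating set but whose union $V_1\cup V_2$ is an independent dominating set; one says that $V_1$ and $V_2$ form an independent coalition. An $ic$-partition of $G$ is a partition $\pi=\{V_1,\dots,V_k\}$ of $V(G)$ into nonempty sets such that every $V_i\in\pi$ either is a singleton dominating set (a dominating set of cardinality 1), or is not an independent dominating set but forms an independent coalition with another set $V_j\in\pi$. The independent coalition number $IC(G)$ is the maximum number of classes of an $ic$-partition of $G$; the assertion $IC(G)=t$ includes that $G$ has an $ic$-partition. *)

(* Defs.v *)
From mathcomp Require Import all_boot.

Set Implicit Arguments.
Unset Strict Implicit.
Unset Printing Implicit Defensive.

Record sgraph := SGraph {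
  svertex :> finType;
  adj : rel svertex;
  adj_sym : symmetric adj;
  adj_irr : irreflexive adj }.

Section GraphOfRel.
Variables (T : finType) (r : rel T).

Definition rel_adj : rel T := fun x y => (x != y) && (r x y || r y x).

Lemma rel_adj_sym : symmetric rel_adj.
Proof. by move=> x y; rewrite /rel_adj eq_sym orbC. Qed.

Lemma rel_adj_irr : irreflexive rel_adj.
Proof. by move=> x; rewrite /rel_adj eqxx. Qed.

(* The loops of [r] are dropped and its arcs made undirected, so an edge need
   only be given in one direction. *)
Definition graph_of_rel : sgraph := SGraph rel_adj_sym rel_adj_irr.

End GraphOfRel.

Definition path_graph (n : nat) : sgraph :=
  graph_of_rel (fun i j : 'I_n => i.+1 == j :> nat).

(* The usual cycle for [3 <= n]. *)
Definition cycle_graph (n : nat) : sgraph :=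
  graph_of_rel (fun i j : 'I_n => i.+1 %% n == j :> nat).

Definition complete_graph (n : nat) : sgraph :=
  graph_of_rel (fun _ _ : 'I_n => true).

Definition edgeless_graph (n : nat) : sgraph :=
  graph_of_rel (fun _ _ : 'I_n => false).

Definition disjoint_union (G H : sgraph) : sgraph :=
  graph_of_rel (fun x y : G + H =>
    match x, y with
    | inl a, inl b => adj a b
    | inr a, inr b => adj a b
    | _, _ => false
    end).

(* [inl i] is v_i and [inr i] is u_i. *)
Definition K0_graph : sgraph :=
  graph_of_rel (fun x y : 'I_4 + 'I_4 =>
    match x, y with
    | inl i, inr j => i != j
    | _, _ => false
    end).

(* [inl (inl i)] is v_i, [inl (inr i)] is u_i, [inr (inl i)] is n_i and
   [inr (inr i)] is m_i. *)
Definition K_graph (k : nat) : sgraph :=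
  graph_of_rel (fun x y : ('I_4 + 'I_4) + ('I_k + 'I_k) =>
    match x, y with
    | inl (inl i), inl (inr j) => i != j
    | inl (inl _), inr (inl _) => true
    | inl (inl _), inr (inr _) => false
    | inl (inr _), inr (inl _) => false
    | inl (inr _), inr (inr _) => true
    | inr (inl i), inr (inr j) => i != j
    | _, _ => false
    end).

Definition isomorphic (G H : sgraph) : Prop :=
  exists2 f : G -> H, bijective f & {mono f : x y / adj x y}.

(* Not necessarily induced. *)
Definition has_subgraph (H G : sgraph) : Prop :=
  exists2 f : H -> G, injective f & {homo f : x y / adj x y}.

Definition triangle_free (G : sgraph) : Prop :=
  ~ has_subgraph (complete_graph 3) G.

Section IndependentCoalitions.
Variable G : sgraph.
Implicit Types (S A B : {set G}) (P : {set {set G}}).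

Definition dominating S : bool :=
  [forall x, (x \in S) || [exists y in S, adj x y]].

Definition independent S : bool :=
  [forall x in S, forall y in S, ~~ adj x y].

Definition ind_dominating S : bool := independent S && dominating S.

Definition ind_coalition A B : bool :=
  [&& [disjoint A & B], independent A, independent B,
      ~~ ind_dominating A, ~~ ind_dominating B & ind_dominating (A :|: B)].

Definition ic_partition P : bool :=
  partition P [set: G] &&
  [forall A in P,
     ((#|A| == 1) && dominating A)
     || (~~ ind_dominating A
         && [exists B in P, (B != A) && ind_coalition A B])].

(* The proposition IC(G) = t: a relation rather than a function, since [G] may
   have no ic-partition. *)
Definition IC_is (t : nat) : Prop :=
  (exists2 P, ic_partition P & #|P| = t)
  /\ (forall P, ic_partition P -> #|P| <= t).

End IndependentCoalitions.

(* Main.v *)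
Require Import Defs.
From mathcomp Require Import all_boot.

Set Implicit Arguments.
Unset Strict Implicit.
Unset Printing Implicit Defensive.

(** A partition into n nonempty classes of a graph of order n consists of
    singletons, and no partition has more classes.  So IC(G) = n says that
    every vertex v is universal, or has a partner: a vertex w, distinct from
    and nonadjacent to v, such that {v, w} dominates (lemma [IC_is_order]).
    It remains to find the triangle-free graphs with this property.

    If there is a universal vertex, the graph is a star, and a leaf has a
    partner only if there are at most two leaves: P_1, P_2, P_3
    ([universal_small]).

    Otherwise every vertex has a partner.  For partners v and w, the sets N(v)
    and N(w) are independent and cover all vertices but v and w.  If a vertex
    c is in both, then N(c) = {v, w}, so a partner d of c must be adjacent to
    all that is left; this makes the graph so small that only C_4, C_5 and P_4
    arise ([common_neighbour_small]).

    If partners never have a common neighbour, then for any partners v and w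
    the sets N(v) + w and N(w) + v are the sides of a bipartition.  When two
    partners a and w lie on the same side, this side is {a, w}, and the graph
    is K_1 + K_2 or 2 K_2 ([same_side_small]).  When all partners lie on
    opposite sides, domination says that each vertex is adjacent to all of the
    opposite side except its partner.  Then partners are matched in pairs and
    the graph is K_{m,m} minus a perfect matching, the crown of order 2m
    ([crossing_crown]).

    The crowns account for the rest of the list: m = 1, 2, 3, 4 give the
    edgeless graph of order 2, 2 K_2, C_6 and K_0, and m = 4 + k gives the
    member of the family K with parameter k, whose bipartition is
    H_1 + H_4, H_2 + H_3 ([K_graph_crown]). *)

(** * Isomorphisms *)

Lemma isomorphic_sym (G H : sgraph) : isomorphic G H -> isomorphic H G.
Proof.
move=> [f [g fK gK] fM]; exists g; first by exists f.
by move=> x y; rewrite -fM !gK.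
Qed.

Lemma isomorphic_trans (G H K : sgraph) :
  isomorphic G H -> isomorphic H K -> isomorphic G K.
Proof.
move=> [f fB fM] [g gB gM]; exists (g \o f); first exact: bij_comp.
by move=> x y /=; rewrite gM fM.
Qed.

(** The way all small graphs are recognised: list the vertices in an order
    under which adjacency becomes the relation [R] between positions.  By
    symmetry, only increasing pairs of positions have to be checked. *)
Lemma isomorphic_listing (G : sgraph) (R : rel nat) (x0 : G) (s : seq G) :
  uniq s -> (forall x, x \in s) ->
  (forall i j, i < j -> j < size s ->
     adj (nth x0 s i) (nth x0 s j) = R i j || R j i) ->
  isomorphic G (graph_of_rel (fun i j : 'I_(size s) => R i j)).
Proof.
move=> sU sT sA; apply: isomorphic_sym.
have nthI : injective (fun i : 'I_(size s) => nth x0 s i).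
  by move=> i j /eqP; rewrite nth_uniq // => /eqP/val_inj.
exists (fun i : 'I_(size s) => nth x0 s i).
  have lt_idx x : index x s < size s by rewrite index_mem.
  exists (fun x => Ordinal (lt_idx x)) => [i|x]; last exact: nth_index.
  by apply: nthI; rewrite /= nth_index.
move=> i j /=; rewrite /rel_adj.
case: (ltngtP i j) => [ij|ji|/val_inj->]; last by rewrite eqxx adj_irr.
- by rewrite sA ?ltn_ord // -val_eqE /= ltn_eqF.
- by rewrite adj_sym sA ?ltn_ord // -val_eqE /= gtn_eqF // orbC.
Qed.

(** * From coalitions to partners *)

Definition universal (G : sgraph) (v : G) : bool :=
  [forall x, (x == v) || adj v x].

(** This says that {v} and {w} form an independent coalition, see
    [ind_coalition1]. *)
Definition partners (G : sgraph) (v w : G) : bool :=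
  [&& v != w, ~~ adj v w
    & [forall x, [|| x == v, x == w, adj v x | adj w x]]].

Definition all_partnered (G : sgraph) : bool :=
  [forall v : G, universal v || [exists w, partners v w]].

Lemma partnersC (G : sgraph) (v w : G) : partners v w = partners w v.
Proof.
rewrite /partners eq_sym adj_sym; congr [&& _, _ & _].
by apply: eq_forallb => x; case: (x == v); case: (x == w);
  case: (adj v x); case: (adj w x).
Qed.

Lemma partnersP (G : sgraph) (v w : G) : partners v w ->
  [/\ v != w, adj v w = false
    & forall x, x != v -> x != w -> adj v x || adj w x].
Proof.
case/and3P=> vw /negbTE nvw /forallP D; split=> // x xv xw.
by have := D x; rewrite (negbTE xv) (negbTE xw).
Qed.

(** This is why a coalition of {v} and {w} need not ask separately that neither
    set dominates. *)
Lemma partners_not_universal (G : sgraph) (v w : G) :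
  partners v w -> ~~ universal v.
Proof.
case/partnersP=> vw nvw _; apply/forallPn; exists w.
by rewrite eq_sym (negbTE vw) nvw.
Qed.

Lemma isomorphic_all_partnered (G H : sgraph) :
  isomorphic G H -> all_partnered H -> all_partnered G.
Proof.
move=> [f fB fM] /forallP Hp; have fI := bij_inj fB.
apply/forallP => v; have /orP[/forallP U|/existsP[w' /and3P[vw nvw /forallP D]]]
  := Hp (f v).
  by apply/orP; left; apply/forallP => x; have := U (f x); rewrite fM inj_eq.
case: fB vw nvw D => g _ gK; rewrite -(gK w') => vw nvw D.
apply/orP; right; apply/existsP; exists (g w'); apply/and3P; split.
- by rewrite -(inj_eq fI).
- by rewrite -fM.
by apply/forallP => x; have := D (f x); rewrite !fM !(inj_eq fI).
Qed.

(** On an explicit graph the property is decided by evaluation: quantification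
    over the list [iota 0 n] computes, quantification over ['I_n] does not. *)
Lemma all_partnered_check (n : nat) (R : rel nat) :
  let a i j := (i != j) && (R i j || R j i) in
  let s := iota 0 n in
  all (fun v => all (fun x => (x == v) || a v x) s
     || has (fun w => [&& v != w, ~~ a v w
              & all (fun x => [|| x == v, x == w, a v x | a w x]) s]) s) s ->
  all_partnered (graph_of_rel (fun i j : 'I_n => R i j)).
Proof.
move=> a s /allP C; have ins (i : 'I_n) : val i \in s by rewrite mem_iota /=.
apply/forallP => v; have /orP[/allP U|/hasP[w]] := C _ (ins v).
  by apply/orP; left; apply/forallP => x; exact: U (ins x).
rewrite mem_iota /= => wn /and3P[vw nvw /allP D].
apply/orP; right; apply/existsP; exists (Ordinal wn); apply/and3P; split=> //.
by apply/forallP => x; exact: D (ins x).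
Qed.

Lemma ind_dominating1 (G : sgraph) (v : G) :
  ind_dominating [set v] = universal v.
Proof.
rewrite /ind_dominating; have -> /= : independent [set v].
  by apply/forall_inP => x /set1P->; apply/forall_inP => y /set1P->;
     rewrite adj_irr.
apply: eq_forallb => x; rewrite inE; congr (_ || _).
apply/exists_inP/idP => [[y /set1P->]|]; first by rewrite adj_sym.
by move=> vx; exists v; rewrite ?set11 // adj_sym.
Qed.

Lemma ind_coalition1 (G : sgraph) (v w : G) :
  ind_coalition [set v] [set w] = partners v w.
Proof.
have I1 (x : G) : independent [set x].
  by apply/forall_inP => y /set1P->; apply/forall_inP => z /set1P->;
     rewrite adj_irr.
have E : ind_dominating ([set v] :|: [set w])
    = ~~ adj v w && [forall x, [|| x == v, x == w, adj v x | adj w x]].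
  rewrite /ind_dominating; congr (_ && _).
    apply/forall_inP/idP => [/(_ v (set21 _ _))/forall_inP/(_ w (set22 _ _))//|].
    move=> nvw x /set2P xE; apply/forall_inP => y /set2P yE.
    by case: xE yE => -> [] ->; rewrite ?adj_irr // adj_sym.
  apply: eq_forallb => x; rewrite !inE -orbA; do 2 congr (_ || _).
  apply/exists_inP/orP => [[y /set2P[]->]|[] h].
  - by rewrite adj_sym; left.
  - by rewrite adj_sym; right.
  - by exists v; rewrite ?set21 // adj_sym.
  - by exists w; rewrite ?set22 // adj_sym.
rewrite /ind_coalition !I1 !ind_dominating1 E /= disjoints1 inE.
apply/and4P/idP => [[vw _ _ /andP[nvw D]]|P]; first exact/and3P.
have /and3P[vw nvw D] := P; split=> //; last by rewrite nvw.
  exact: partners_not_universal P.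
by rewrite partnersC in P; exact: partners_not_universal P.
Qed.

(** The classes of a partition are nonempty and their cardinals sum to the order
    of the graph.  Hence there are at most that many classes, and equality
    forces every class to be a singleton. *)
Lemma IC_is_order (G : sgraph) : IC_is G #|G| <-> all_partnered G.
Proof.
have blocks_gt0 (P : {set {set G}}) : partition P [set: G] ->
    forall A, A \in P -> 0 < #|A|.
  by move=> /and3P[_ _ P0] A AP; rewrite card_gt0; apply: contraNneq P0 => <-.
split=> [[[P /andP[Ppart /forall_inP Pic] Pn] _]|/forallP Gp].
  have gt0 := blocks_gt0 P Ppart.
  have card1 A : A \in P -> #|A| = 1.
    have := leqif_sum (fun A (AP : A \in P) => leqif_eq (gt0 A AP)).
    rewrite sum1_card -(card_partition Ppart) cardsT Pn => -[_].
    by rewrite eqxx => /esym/forall_inP c1 AP; apply/esym/eqP/c1.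
  have inP v : [set v] \in P.
    have vcov : v \in cover P by rewrite (cover_partition Ppart) inE.
    have /eqP/cards1P[u Eu] := card1 _ (pblock_mem vcov).
    by have := vcov; rewrite -mem_pblock Eu => /set1P->; rewrite -Eu pblock_mem.
  apply/forallP => v; have /orP[/andP[_ D]|/andP[_ /exists_inP[B BP]]] := Pic _ (inP v).
    rewrite -ind_dominating1 /ind_dominating D andbT.
    apply/orP; left; apply/forall_inP => y /set1P->.
    by apply/forall_inP => z /set1P->; rewrite adj_irr.
  have /eqP/cards1P[w ->] := card1 _ BP.
  by case/andP=> _; rewrite ind_coalition1 => vw; apply/orP; right; apply/existsP; exists w.
split; last first.
  move=> P /andP[Ppart _]; rewrite -cardsT (card_partition Ppart) -sum1_card.
  by apply: leq_sum => A; exact: blocks_gt0.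
exists [set [set x] | x in [set: G]]; last first.
  by rewrite card_imset ?cardsT //; exact: set1_inj.
apply/andP; split.
  apply/and3P; split.
  - apply/eqP/setP => x; rewrite inE; apply/bigcupP.
    by exists [set x]; rewrite ?set11 // imset_f.
  - apply/trivIsetP => _ _ /imsetP[x _ ->] /imsetP[y _ ->] xy.
    by rewrite disjoints1 inE; apply: contraNneq xy => ->.
  - by apply/imsetP => -[x _ /setP/(_ x)]; rewrite !inE eqxx.
apply/forall_inP => _ /imsetP[v _ ->]; rewrite cards1 /= ind_dominating1.
have [U|nU] := boolP (universal v).
  by move: U; rewrite -ind_dominating1 => /andP[_ ->].
apply/orP; right; have := Gp v; rewrite (negbTE nU) => /existsP[w vw].
apply/exists_inP; exists [set w]; first exact: imset_f.
rewrite ind_coalition1 vw andbT eq_sym (inj_eq set1_inj).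
by case/and3P: vw.
Qed.

(** * Crown graphs and the listed graphs *)

(** K_{m,m} minus a perfect matching. *)
Definition crown (m : nat) : sgraph :=
  graph_of_rel (fun x y : 'I_m + 'I_m =>
    match x, y with
    | inl i, inr j => i != j
    | _, _ => false
    end).

Lemma all_partnered_crown m : all_partnered (crown m).
Proof.
apply/forallP => v; apply/orP; right; apply/existsP.
pose w : crown m := match v with inl i => inr i | inr i => inl i end.
exists w; rewrite {}/w; apply/and3P; split.
- by case: v.
- by case: v => i; rewrite /adj /= /rel_adj /= eqxx.
apply/forallP => x; case: v x => [i|i] [j|j];
  (have [->|ji] := eqVneq j i; first by rewrite eqxx ?orbT);
  by rewrite /= /rel_adj /= ?[i == j]eq_sym ?ji ?orbT.
Qed.

(** There are no edges between H_1 and H_4, nor between H_2 and H_3, so H_1 with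
    H_4 and H_2 with H_3 are the two sides; each vertex misses exactly the one
    with its own index on the opposite side. *)
Lemma K_graph_crown k : isomorphic (K_graph k) (crown (4 + k)).
Proof.
pose f (x : K_graph k) : crown (4 + k) :=
  match x with
  | inl (inl i) => inl (lshift k i)
  | inl (inr i) => inr (lshift k i)
  | inr (inl i) => inr (rshift 4 i)
  | inr (inr i) => inl (rshift 4 i)
  end.
have fI : injective f.
  move=> [[i|i]|[i|i]] [[j|j]|[j|j]] //= /eqP;
    rewrite ?(inj_eq inl_inj) ?(inj_eq inr_inj)
      ?eq_lshift ?eq_rshift ?eq_lrshift ?eq_rlshift //;
    by move=> /eqP->.
exists f.
  by apply: inj_card_bij fI _; rewrite !card_sum !card_ord addnACA.
by move=> [[i|i]|[i|i]] [[j|j]|[j|j]]; rewrite /= /rel_adj /=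
  ?eq_lshift ?eq_rshift ?eq_lrshift ?eq_rlshift ?andbF ?orbF
  ?[j == i]eq_sym.
Qed.

Lemma crown1 : isomorphic (crown 1) (edgeless_graph 2).
Proof.
apply: (@isomorphic_listing (crown 1) (fun _ _ => false) (inl ord0)
  [:: inl ord0; inr ord0]) => //.
  by move=> [i|i]; rewrite (ord1 i).
by move=> [|[|i]] [|[|j]].
Qed.

(** The graphs 2 K_2 and K_1 + K_2 on positions, as a common target for
    [isomorphic_listing]: neither a crown nor a disjoint union has ordinals as
    vertices. *)
Definition two_edges : rel nat :=
  fun i j => (i == 0) && (j == 1) || (i == 2) && (j == 3).

Definition point_edge : rel nat := fun i j => (i == 1) && (j == 2).

Lemma crown2_listing :
  isomorphic (crown 2) (graph_of_rel (fun i j : 'I_4 => two_edges i j)).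
Proof.
apply: (@isomorphic_listing (crown 2) _ (inl ord0)
  [:: inl ord0; inr ord_max; inl ord_max; inr ord0]) => //.
  by move=> [[[|[|//]] ?]|[[|[|//]] ?]].
by move=> [|[|[|[|i]]]] [|[|[|[|j]]]].
Qed.

Lemma K2K2_listing :
  isomorphic (disjoint_union (complete_graph 2) (complete_graph 2))
    (graph_of_rel (fun i j : 'I_4 => two_edges i j)).
Proof.
apply: (@isomorphic_listing
  (disjoint_union (complete_graph 2) (complete_graph 2)) two_edges (inl ord0)
  [:: inl ord0; inl ord_max; inr ord0; inr ord_max]) => //.
  by move=> [[[|[|//]] ?]|[[|[|//]] ?]].
by move=> [|[|[|[|i]]]] [|[|[|[|j]]]].
Qed.

Lemma K1K2_listing :
  isomorphic (disjoint_union (complete_graph 1) (complete_graph 2))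
    (graph_of_rel (fun i j : 'I_3 => point_edge i j)).
Proof.
apply: (@isomorphic_listing
  (disjoint_union (complete_graph 1) (complete_graph 2)) point_edge (inl ord0)
  [:: inl ord0; inr ord0; inr ord_max]) => //.
  by move=> [[[|//] ?]|[[|[|//]] ?]].
by move=> [|[|[|i]]] [|[|[|j]]].
Qed.

(** Around the cycle the sides alternate, and antipodal vertices are the
    nonadjacent ones of opposite sides. *)
Lemma crown3 : isomorphic (crown 3) (cycle_graph 6).
Proof.
pose o1 : 'I_3 := Ordinal (isT : 1 < 3).
apply: (@isomorphic_listing (crown 3) (fun i j => i.+1 %% 6 == j) (inl ord0)
  [:: inl ord0; inr o1; inl ord_max; inr ord0; inl o1; inr ord_max]) => //.
  by move=> [[[|[|[|//]]] ?]|[[|[|[|//]]] ?]].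
by move=> [|[|[|[|[|[|i]]]]]] [|[|[|[|[|[|j]]]]]].
Qed.

(** * Triangle-free graphs with partners *)

Lemma triangle_freeP (G : sgraph) (x y z : G) :
  triangle_free G -> adj x y -> adj y z -> adj x z = false.
Proof.
move=> tf xy yz; apply/negP => xz; apply: tf.
have ne (a b : G) : adj a b -> (a == b) = false.
  by apply: contraTF => /eqP->; rewrite adj_irr.
have U : uniq [:: x; y; z] by rewrite /= !inE !ne.
exists (fun i : 'I_3 => nth x [:: x; y; z] i).
  by move=> i j /eqP; rewrite nth_uniq // => /eqP/val_inj.
by move=> [[|[|[|//]]] ?] [[|[|[|//]]] ?] //= _; rewrite // adj_sym.
Qed.

Section Classification.
Variable G : sgraph.
Hypothesis tf : triangle_free G.

Let tri (x y z : G) : adj x y -> adj y z -> adj x z = false.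
Proof. exact: triangle_freeP. Qed.

Let adj_neq (x y : G) : adj x y -> (x == y) = false.
Proof. by apply: contraTF => /eqP->; rewrite adj_irr. Qed.

(** The neighbours of [u] are independent, so G is a star.  If it has two leaves,
    a leaf [x] is not universal; its partner [w] is another leaf, and a third
    leaf would be dominated by neither. *)
Lemma universal_small (u : G) : all_partnered G -> universal u ->
  [\/ isomorphic G (path_graph 1), isomorphic G (path_graph 2)
    | isomorphic G (path_graph 3)].
Proof.
move=> /forallP Gp /forallP U.
have uadj x : x != u -> adj u x by move=> xu; have := U x; rewrite (negbTE xu).
have uind x y : x != u -> y != u -> adj x y = false.
  by move=> /uadj ux /uadj uy; rewrite (tri (y := u)) // adj_sym.
have [x xu|only_u] := pickP (fun x => x != u); last first.
  constructor 1.
  apply: (@isomorphic_listing G (fun i j => i.+1 == j) u [:: u]) => //.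
    by move=> x; rewrite inE; apply/negbFE/only_u.
  by move=> [|i] [|j].
have [y /andP[yu yx]|only_ux] := pickP (fun y => (y != u) && (y != x));
    last first.
  constructor 2.
  apply: (@isomorphic_listing G (fun i j => i.+1 == j) u [:: u; x]) => //.
  - by rewrite /= inE eq_sym xu.
  - move=> y; rewrite !inE; have := only_ux y.
    by case: eqP => //= _; case: eqP.
  - by move=> [|[|i]] [|[|j]] //= _ _; rewrite uadj.
have nUx : ~~ universal x.
  by apply/forallPn; exists y; rewrite (negbTE yx) uind.
have := Gp x; rewrite (negbTE nUx) => /existsP[w /partnersP[xw nxw D]].
have wu : w != u by apply: contraFneq nxw => ->; rewrite adj_sym uadj.
constructor 3.
apply: (@isomorphic_listing G (fun i j => i.+1 == j) u [:: x; u; w]) => //.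
- by rewrite /= !inE (negbTE xu) (negbTE xw) eq_sym wu.
- move=> z; rewrite !inE; case: eqVneq => //= zx; case: eqVneq => //= zu.
  by apply/negPn/negP => zw; have := D z zx zw; rewrite !uind.
- by move=> [|[|[|i]]] [|[|[|j]]] //= _ _; rewrite ?uadj ?nxw // adj_sym uadj.
Qed.

(** By triangle-freeness [c] has no neighbours but [v] and [w], so its partner [d]
    is adjacent to every remaining vertex.  If [d] is adjacent to both [v] and
    [w], no vertex remains.  If, say, [w] is not adjacent to [d], the remaining
    vertices are adjacent to [w] and [d] only, and there is at most one:
    with two of them, one would have no partner. *)
Lemma common_neighbour_small (v w c : G) :
  (forall x : G, exists y, partners x y) ->
  partners v w -> adj v c -> adj w c ->
  [\/ isomorphic G (cycle_graph 4), isomorphic G (cycle_graph 5)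
    | isomorphic G (path_graph 4)].
Proof.
move=> Gp vwP vc wc; have [d cdP] := Gp c.
wlog vd : v w vwP vc wc / adj v d => [hwlog|].
  have [_ _ D] := partnersP vwP; have [_ ncd _] := partnersP cdP.
  have dv : d != v by apply: contraFneq ncd => ->; rewrite adj_sym.
  have dw : d != w by apply: contraFneq ncd => ->; rewrite adj_sym.
  have /orP[] := D d dv dw; first exact: hwlog vwP vc wc.
  by rewrite partnersC in vwP; exact: hwlog vwP wc vc.
have [vw nvw D] := partnersP vwP; have [cd ncd Dcd] := partnersP cdP.
have cv : adj c v by rewrite adj_sym.
have cw : adj c w by rewrite adj_sym.
have dv : adj d v by rewrite adj_sym.
have dw : d != w by apply: contraFneq ncd => ->; exact: cw.
have cadj x : x != v -> x != w -> adj c x = false.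
  move=> xv xw; have /orP[vx|wx] := D x xv xw; [exact: tri cv vx|exact: tri cw wx].
have dadj x : x != v -> x != w -> x != c -> x != d -> adj d x.
  by move=> xv xw xc xd; have := Dcd x xc xd; rewrite cadj.
have vadj x : x != c -> x != d -> adj v x = false.
  move=> xc xd; have [->|xv] := eqVneq x v; first exact: adj_irr.
  have [->|xw] := eqVneq x w; first exact: nvw.
  exact: tri vd (dadj _ _ _ _ _).
have rest x : x != v -> x != w -> x != c -> x != d -> adj w x.
  by move=> xv xw xc xd; have := D x xv xw; rewrite vadj.
have vc' := adj_neq vc; have vd' := adj_neq vd; have cw' := adj_neq cw.
have wv := vw; rewrite eq_sym in wv; have wd := dw; rewrite eq_sym in wd.
have [wdA|nwd] := boolP (adj w d).
  constructor 1.
  apply: (@isomorphic_listing G (fun i j => i.+1 %% 4 == j) v [:: v; c; w; d])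
    => //.
  - by rewrite /= !inE vc' vd' cw' (negbTE vw) (negbTE cd) (negbTE wd).
  - move=> x; rewrite !inE.
    case: eqVneq => //= xv; case: eqVneq => //= xc.
    case: eqVneq => //= xw; case: eqVneq => //= xd.
    by have := tri wdA (dadj x xv xw xc xd); rewrite rest.
  - by move=> [|[|[|[|i]]]] [|[|[|[|j]]]].
have [b /and4P[bv bw bc bd]|none] :=
    pickP (fun x => [&& x != v, x != w, x != c & x != d]); last first.
  constructor 3.
  apply: (@isomorphic_listing G (fun i j => i.+1 == j) v [:: d; v; c; w])
    => //.
  - by rewrite /= !inE vc' cw' (negbTE vw) (negbTE dw) eq_sym vd' eq_sym (negbTE cd).
  - move=> x; rewrite !inE; have /negbT := none x.
    by rewrite !negb_and !negbK; case/or4P=> ->; rewrite ?orbT.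
  - move=> [|[|[|[|i]]]] [|[|[|[|j]]]] //= _ _; rewrite ?nvw //; rewrite adj_sym //.
    exact: negbTE.
(* With a second remaining vertex x, the partner z of b can be neither w nor d,
   which are adjacent to b.  If z = x, then v is not dominated; if z is v, c or
   a third remaining vertex, then x is not dominated. *)
have only_b x : x != v -> x != w -> x != c -> x != d -> x = b.
  move=> xv xw xc xd; apply/eqP; apply/negPn/negP => xb.
  have db := dadj b bv bw bc bd; have wb := rest b bv bw bc bd.
  have bx : adj b x = false.
    by rewrite (tri (y := d)) ?dadj // adj_sym.
  have [z bzP] := Gp b; have [bz nbz Db] := partnersP bzP.
  have zw : z != w by apply: contraFneq nbz => ->; rewrite adj_sym.
  have zd : z != d by apply: contraFneq nbz => ->; rewrite adj_sym.
  have [zx|zx] := eqVneq z x.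
    have := Db v; rewrite eq_sym bv zx eq_sym xv => /(_ isT isT).
    by rewrite ![adj _ v]adj_sym !vadj.
  rewrite eq_sym in zx; have := Db x xb zx; rewrite bx /=.
  have [->|zv] := eqVneq z v; first by rewrite vadj.
  have [->|zc] := eqVneq z c; first by rewrite cadj.
  by rewrite (tri (y := d)) ?dadj // adj_sym dadj.
have db := dadj b bv bw bc bd; have wb := rest b bv bw bc bd.
constructor 2.
apply: (@isomorphic_listing G (fun i j => i.+1 %% 5 == j) v [:: v; c; w; b; d])
  => //.
- rewrite /= !inE vc' vd' cw' (negbTE vw) (negbTE cd) (negbTE wd).
  by rewrite ![_ == b]eq_sym (negbTE bv) (negbTE bw) (negbTE bc) (negbTE bd).
- move=> x; rewrite !inE.
  case: eqVneq => //= xv; case: eqVneq => //= xc.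
  case: eqVneq => //= xw; case: (eqVneq x d) => [|xd]; first by rewrite orbT.
  by rewrite (only_b x) ?eqxx.
- move=> [|[|[|[|[|i]]]]] [|[|[|[|[|j]]]]] //= _ _.
  all: by rewrite ?nvw ?ncd ?vadj ?cadj ?(negbTE nwd) // adj_sym.
Qed.

Hypothesis no_common : forall v w c : G,
  partners v w -> adj v c -> adj w c = false.

(** Each vertex [x] other than [v], [w], [a] is adjacent to [w], since adjacency
    to both [v] and [a] would give a triangle; hence to neither [v] nor [a].
    So the edge v-a and the star with centre [w] are separate components, and
    the star has at most one leaf for its leaves to have partners. *)
Lemma same_side_small (v w a : G) :
  (forall x : G, exists y, partners x y) ->
  partners v w -> partners a w -> adj v a ->
  isomorphic G (graph_of_rel (fun i j : 'I_3 => point_edge i j)) \/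
  isomorphic G (graph_of_rel (fun i j : 'I_4 => two_edges i j)).
Proof.
move=> Gp vwP awP va.
have [vw nvw D] := partnersP vwP; have [aw naw Da] := partnersP awP.
have va' := adj_neq va.
have rest x : x != v -> x != w -> x != a ->
    [/\ adj w x, adj v x = false & adj a x = false].
  move=> xv xw xa; have wx : adj w x.
    have /orP[vx|//] := D x xv xw; have /orP[ax|//] := Da x xa xw.
    by move: vx; rewrite (tri va ax).
  split=> //; [rewrite partnersC in vwP|rewrite partnersC in awP].
    exact: no_common vwP wx.
  exact: no_common awP wx.
have [b /and3P[bv bw ba]|none] :=
    pickP (fun x => [&& x != v, x != w & x != a]); last first.
  left.
  apply: (@isomorphic_listing G point_edge v [:: w; v; a]) => //.
  - by rewrite /= !inE va' eq_sym (negbTE vw) eq_sym (negbTE aw).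
  - move=> x; rewrite !inE; have /negbT := none x.
    by rewrite !negb_and !negbK; case/or3P=> ->; rewrite ?orbT.
  - by move=> [|[|[|i]]] [|[|[|j]]] //= _ _; rewrite adj_sym.
right; have [wb nvb nab] := rest b bv bw ba.
(* If x is a second leaf, the partner z of b fails to dominate x when z is v
   or a, and fails to dominate v when z is a leaf. *)
have only_b x : x != v -> x != w -> x != a -> x = b.
  move=> xv xw xa; apply/eqP; apply/negPn/negP => xb.
  have [wx nvx nax] := rest x xv xw xa.
  have nbx : adj b x = false by rewrite (tri (y := w)) // adj_sym.
  have [z bzP] := Gp b; have [bz nbz Db] := partnersP bzP.
  have zw : z != w by apply: contraFneq nbz => ->; rewrite adj_sym.
  have vb : v != b by rewrite eq_sym.
  have ab : a != b by rewrite eq_sym.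
  have [zv|zv] := eqVneq z v.
    have := Db x xb; rewrite zv => /(_ xv).
    by rewrite nbx nvx.
  have [za|za] := eqVneq z a.
    have := Db x xb; rewrite za => /(_ xa).
    by rewrite nbx nax.
  have [wz nvz naz] := rest z zv zw za.
  have vz : v != z by rewrite eq_sym.
  by have := Db v vb vz; rewrite ![adj _ v]adj_sym nvb nvz.
apply: (@isomorphic_listing G two_edges v [:: v; a; w; b]) => //.
- rewrite /= !inE va' (negbTE vw) (negbTE aw).
  by rewrite ![_ == b]eq_sym (negbTE bv) (negbTE bw) (negbTE ba).
- move=> x; rewrite !inE.
  case: eqVneq => //= xv; case: eqVneq => //= xa; case: eqVneq => //= xw.
  by rewrite (only_b x) ?eqxx.
- by move=> [|[|[|[|i]]]] [|[|[|[|j]]]].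
Qed.

(** The sides are N(v0) + w0 and N(w0) + v0.  Two partners on the same side
    would have to be the whole side, because the side is independent; one of
    them would be w0 (or v0) and the other a neighbour of v0 (or w0), which
    [cross] excludes.  With partners on opposite sides, a vertex y opposite to x
    that is not the partner of x cannot be dominated by that partner, which is
    on the side of y, so it is adjacent to x. *)
Lemma crossing_crown (v0 w0 : G) :
  (forall x : G, exists y, partners x y) -> partners v0 w0 ->
  (forall v w a : G, partners v w -> partners a w -> adj v a = false) ->
  exists m, isomorphic G (crown m).
Proof.
move=> Gp vwP cross; have [vw nvw D] := partnersP vwP.
pose side x := (x == w0) || adj v0 x.
have side_indep (v w x y : G) : partners v w ->
    (x == w) || adj v x -> (y == w) || adj v y -> adj x y = false.
  move=> P; have NC := no_common P.
  case/orP=> [/eqP->|vx] /orP[/eqP->|vy]; rewrite ?adj_irr ?NC //.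
    by rewrite adj_sym NC.
  by rewrite (tri (y := v)) // adj_sym.
have not_same (v w x y : G) : partners v w ->
    (x == w) || adj v x -> (y == w) || adj v y -> partners x y = false.
  move=> P sx sy; apply/negP => Q; have [xy _ Dxy] := partnersP Q.
  have [Ex|xw] := eqVneq w x.
    move: sy Q; rewrite -Ex in xy *; rewrite eq_sym (negbTE xy) /= => vy.
    by rewrite partnersC => Q; rewrite (cross v w y) in vy.
  have [Ey|yw] := eqVneq w y.
    move: sx Q; rewrite -Ey in xy *; rewrite (negbTE xy) /= => vx Q.
    by rewrite (cross v w x) in vx.
  have := Dxy w xw yw.
  by rewrite (side_indep v w x w P sx) ?(side_indep v w y w P sy) ?eqxx.
have sideN x : ~~ side x -> (x == v0) || adj w0 x.
  rewrite /side negb_or => /andP[xw nvx].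
  by case: eqVneq => //= xv; have := D x xv xw; rewrite (negbTE nvx).
have wvP : partners w0 v0 by rewrite partnersC.
have side_proper x y : adj x y -> side x = ~~ side y.
  case: (boolP (side x)) => sx; case: (boolP (side y)) => sy //.
    by rewrite (side_indep v0 w0).
  by rewrite (side_indep w0 v0) ?sideN.
have partner_side x y : partners x y -> side x = ~~ side y.
  case: (boolP (side x)) => sx; case: (boolP (side y)) => sy //.
    by rewrite (not_same v0 w0).
  by rewrite (not_same w0 v0) ?sideN.
pose p x := xchoose (Gp x).
have pP x : partners x (p x) := xchooseP (Gp x).
have adjE x y : side x = ~~ side y -> adj x y = (y != p x).
  move=> xy; have [xpx nxpx Dx] := partnersP (pP x).
  have [->|ypx] := eqVneq y (p x); first exact: nxpx.
  have yx : y != x by apply: contra_eq_neq xy => ->; case: (side x).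
  have /orP[//|/side_proper] := Dx y yx ypx.
  by move=> E; move: (partner_side _ _ (pP x)); rewrite E xy negbK; case: (side y).
have pK x : p (p x) = x.
  have := adjE (p x) x; rewrite (partner_side _ _ (pP x)) negbK => /(_ erefl).
  have [_ + _] := partnersP (pP x); rewrite adj_sym => ->.
  by move/esym/negbFE/eqP.
pose A := [set x | side x].
exists #|A|; apply: isomorphic_sym.
(* The isomorphism numbers one side and sends each number on the other side to
   the partner of the vertex with this number. *)
pose f (x : crown #|A|) : G :=
  match x with inl i => enum_val i | inr i => p (enum_val i) end.
have sA (i : 'I_#|A|) : side (enum_val i).
  by have := enum_valP i; rewrite inE.
have sB (i : 'I_#|A|) : side (p (enum_val i)) = false.
  by have := partner_side _ _ (pP (enum_val i)); rewrite sA; case: (side _).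
have fI : injective f.
  move=> [i|i] [j|j] /= E.
  - by rewrite (enum_val_inj E).
  - by have := sA i; rewrite E sB.
  - by have := sA j; rewrite -E sB.
  - by rewrite (enum_val_inj (can_inj pK E)).
have fS x : exists i, f i == x.
  have [xA|xA] := boolP (x \in A).
    by exists (inl (enum_rank_in xA x)); rewrite /= enum_rankK_in ?pK.
  have pxA : p x \in A.
    by move: xA; rewrite !inE (partner_side _ _ (pP x)) negbK.
  by exists (inr (enum_rank_in pxA (p x))); rewrite /= enum_rankK_in ?pK.
exists f.
  pose g x := xchoose (fS x).
  have gK : cancel g f by move=> x; exact/eqP/(xchooseP (fS x)).
  by exists g => // i; apply: fI; rewrite gK.
have same x y : side x = side y -> adj x y = false.
  move=> xy; apply/negP => /side_proper; rewrite xy; by case: (side y).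
have inv_eq (i j : 'I_#|A|) : (p (enum_val j) != p (enum_val i)) = (i != j).
  by rewrite (inj_eq (can_inj pK)) (inj_eq enum_val_inj) eq_sym.
move=> [i|i] [j|j] /=; rewrite /rel_adj /= ?andbF ?orbF.
- by rewrite same ?sA.
- by rewrite adjE ?sA ?sB // inv_eq.
- by rewrite adj_sym adjE ?sA ?sB // inv_eq.
- by rewrite same ?sB.
Qed.

End Classification.

(** * The classification *)

Lemma all_partnered_classification (G : sgraph) :
  0 < #|G| -> triangle_free G -> all_partnered G ->
  [\/ exists2 n, 0 < n <= 4 & isomorphic G (path_graph n),
      exists2 n, 4 <= n <= 5 & isomorphic G (cycle_graph n),
      isomorphic G (disjoint_union (complete_graph 1) (complete_graph 2))
    | exists2 m, 0 < m & isomorphic G (crown m)].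
Proof.
move=> /card_gt0P[x0 _] tf Gp.
have [u uU|nU] := pickP (@universal G).
  by constructor 1; case: (universal_small tf Gp uU);
    [exists 1|exists 2|exists 3].
have {Gp} ex (x : G) : exists y, partners x y.
  by move/forallP: Gp => /(_ x); rewrite nU => /existsP.
have [t|none] := pickP (fun t : G * G * G =>
    [&& partners t.1.1 t.1.2, adj t.1.1 t.2 & adj t.1.2 t.2]).
  case/and3P=> P vc wc; case: (common_neighbour_small tf ex P vc wc) => I.
  - by constructor 2; exists 4.
  - by constructor 2; exists 5.
  - by constructor 1; exists 4.
have {none} nc (v w c : G) : partners v w -> adj v c -> adj w c = false.
  by move=> P vc; have := none (v, w, c); rewrite /= P vc.
have [t|none] := pickP (fun t : G * G * G =>
    [&& partners t.1.1 t.1.2, partners t.2 t.1.2 & adj t.1.1 t.2]).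
  case/and3P=> P Q va; case: (same_side_small tf nc ex P Q va) => I.
    by constructor 3; exact: isomorphic_trans I (isomorphic_sym K1K2_listing).
  constructor 4; exists 2 => //.
  exact: isomorphic_trans I (isomorphic_sym crown2_listing).
have [y xyP] := ex x0.
have [|m I] := crossing_crown tf nc ex xyP.
  by move=> v w a P Q; have := none (v, w, a); rewrite /= P Q.
constructor 4; exists m => //; case: m I => // -[f _ _].
by case: (f x0) => -[].
Qed.

Theorem corollary5p13 (G : sgraph) (n : nat) :
  0 < #|G| -> #|G| = n -> triangle_free G ->
  (IC_is G n <->
     (isomorphic G (cycle_graph 4)
      \/ isomorphic G (cycle_graph 5)
      \/ isomorphic G (cycle_graph 6)
      \/ isomorphic G (path_graph 1)
      \/ isomorphic G (path_graph 2)
      \/ isomorphic G (path_graph 3)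
      \/ isomorphic G (path_graph 4)
      \/ isomorphic G (edgeless_graph 2)
      \/ isomorphic G (disjoint_union (complete_graph 1) (complete_graph 2))
      \/ isomorphic G (disjoint_union (complete_graph 2) (complete_graph 2))
      \/ isomorphic G K0_graph
      \/ (exists2 k : nat, 1 <= k & isomorphic G (K_graph k)))).
Proof.
move=> G0 <- tf; have crown_part H m : isomorphic H (crown m) -> all_partnered H.
  by move/isomorphic_all_partnered; apply; exact: all_partnered_crown.
split=> [/IC_is_order/(all_partnered_classification G0 tf)|].
  case=> [[k k4 I]|[k k5 I]|I|[m m0 I]].
  - by case: k k4 I => [|[|[|[|[|k]]]]] // _; tauto.
  - by case: k k5 I => [|[|[|[|[|[|k]]]]]] // _; tauto.
  - tauto.
  case: m m0 I => [|[|[|[|[|k]]]]] // _ I.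
  - by have := isomorphic_trans I crown1; tauto.
  - have := isomorphic_trans (isomorphic_trans I crown2_listing)
      (isomorphic_sym K2K2_listing).
    by tauto.
  - by have := isomorphic_trans I crown3; tauto.
  - by have : isomorphic G K0_graph := I; tauto.
  - do 11 right; exists k.+1 => //.
    exact: isomorphic_trans I (isomorphic_sym (K_graph_crown k.+1)).
move=> I; apply/IC_is_order.
case: I => [I|[I|[I|[I|[I|[I|[I|[I|[I|[I|[I|[k k1 I]]]]]]]]]]]].
- by apply: isomorphic_all_partnered I _;
    exact: (@all_partnered_check 4 (fun i j => i.+1 %% 4 == j)).
- by apply: isomorphic_all_partnered I _;
    exact: (@all_partnered_check 5 (fun i j => i.+1 %% 5 == j)).
- exact: crown_part (isomorphic_trans I (isomorphic_sym crown3)).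
- by apply: isomorphic_all_partnered I _;
    exact: (@all_partnered_check 1 (fun i j => i.+1 == j)).
- by apply: isomorphic_all_partnered I _;
    exact: (@all_partnered_check 2 (fun i j => i.+1 == j)).
- by apply: isomorphic_all_partnered I _;
    exact: (@all_partnered_check 3 (fun i j => i.+1 == j)).
- by apply: isomorphic_all_partnered I _;
    exact: (@all_partnered_check 4 (fun i j => i.+1 == j)).
- exact: crown_part (isomorphic_trans I (isomorphic_sym crown1)).
- apply: isomorphic_all_partnered (isomorphic_trans I K1K2_listing) _.
  exact: (@all_partnered_check 3 point_edge).
- exact: crown_part (isomorphic_trans (isomorphic_trans I K2K2_listing)
    (isomorphic_sym crown2_listing)).
- exact: crown_part (I : isomorphic G (crown 4)).
- exact: crown_part (isomorphic_trans I (K_graph_crown k)).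
Qed.
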